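(* Let $p$ be an odd prime and let $\mathcal{L}=(L_1,\dots,L_m)$ be a system of linear forms in $d$ variables with coefficients in $\mathbb{F}_p$, written $L_i(x_1,\dots,x_d)=\sum_{r=1}^d\gamma^{(i)}_r x_r$. Suppose that the $d\times d$ matrices $\Gamma^{(i)}=(\gamma^{(i)}_r\gamma^{(i)}_s)_{r,s=1}^d$, $i=1,\dots,m$, are linearly dependent over $\mathbb{F}_p$ (i.e. the quadratic forms $L_i^TL_i$ are linearly dependent). Then there exists $\epsilon>0$ such that for every $\delta>0$ there exist $n$ and a set $A\subset\mathbb{F}_p^n$, of density $\alpha=|A|/p^n$, with the following two properties: (i) the balanced function $f=1_A-\alpha$ satisfies $\|f\|_{U^2}\le\delta$; (ii) if $\mathbf{x}=(x_1,\dots,x_d)$ is chosen uniformly at random from $(\mathbb{F}_p^n)^d$, then the probability that $L_i(\mathbf{x})\in A$ for every $i=1,\dots,m$ is at least $\alpha^m+\epsilon$.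
   Context: For $\mathbf{x}=(x_1,\dots,x_d)\in(\mathbb{F}_p^n)^d$, $L_i(\mathbf{x})=\sum_r\gamma^{(i)}_r x_r\in\mathbb{F}_p^n$. For $f:\mathbb{F}_p^n\to\mathbb{C}$, the $U^2$-norm is defined by $\|f\|_{U^2}^4=\mathbb{E}_{x,h_1,h_2\in\mathbb{F}_p^n}f(x)\overline{f(x+h_1)}\,\overline{f(x+h_2)}f(x+h_1+h_2)$, expectations being uniform averages. $1_A$ denotes the characteristic function of $A$. *)

(* Defs.v *)
From HB Require Import structures.
From mathcomp Require Import all_boot all_order all_algebra all_field.
From mathcomp Require Import reals.
Set Implicit Arguments. Unset Strict Implicit. Unset Printing Implicit Defensive.
Import Order.TTheory GRing.Theory Num.Theory.
Local Open Scope ring_scope.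

Definition avg (T : finType) (R : numFieldType) (F : T -> R) : R :=
  (\sum_(x : T) F x) / #|T|%:R.

(* ||f||_{U^2}^4 for a real-valued f on F_p^n (complex conjugation is trivial). *)
Definition U2_pow4 (p n : nat) (R : numFieldType) (f : 'rV['F_p]_n -> R) : R :=
  avg (fun x : 'rV['F_p]_n => avg (fun h1 : 'rV['F_p]_n => avg (fun h2 : 'rV['F_p]_n =>
     f x * f (x + h1) * f (x + h2) * f (x + h1 + h2)))).

Definition U2norm (p n : nat) (R : rcfType) (f : 'rV['F_p]_n -> R) : R :=
  Num.sqrt (Num.sqrt (U2_pow4 f)).

Definition linform (p n d : nat) (g : 'I_d -> 'F_p) (x : {ffun 'I_d -> 'rV['F_p]_n}) : 'rV['F_p]_n :=
  \sum_(r < d) g r *: x r.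

Definition quad_forms_lin_dep (p m d : nat) (gamma : 'I_m -> 'I_d -> 'F_p) : Prop :=
  exists c : 'I_m -> 'F_p, (exists i, c i != 0) /\
    forall r s : 'I_d, \sum_(i < m) c i * (gamma i r * gamma i s) = 0.

Definition density (p n : nat) (R : numFieldType) (A : {set 'rV['F_p]_n}) : R :=
  #|A|%:R / (p ^ n)%:R.

Definition pattern_prob (p n m d : nat) (R : numFieldType)
   (gamma : 'I_m -> 'I_d -> 'F_p) (A : {set 'rV['F_p]_n}) : R :=
  avg (fun x : {ffun 'I_d -> 'rV['F_p]_n} =>
        ([forall i : 'I_m, linform (gamma i) x \in A] : bool)%:R).

(* Main.v *)
(** Take A = {(y, z) in F_p^k x F_p^k : y . z = 0}, for k large. For fixed y,
    the m conditions L_i(y) . L_i(z) = 0 are homogeneous linear equations in z,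
    and the dependence of the matrices Gamma^(i) makes one of them a consequence
    of the m - 1 others; so the pattern has probability at least p^-(m-1), while
    A has density close to p^-1. The balanced function f of A is U^2-small
    because ||f||_{U^2}^4 is the mean over h of (E_x f(x) f(x + h))^2, and for
    h = (a, b) with a <> 0 the events x \in A and x + h \in A impose
    independent linear conditions on z as soon as y is not a multiple of a. *)

Require Import Defs.
From HB Require Import structures.
From mathcomp Require Import all_boot all_order all_algebra all_field.
From mathcomp Require Import reals ring lra.
Set Implicit Arguments. Unset Strict Implicit. Unset Printing Implicit Defensive.
Import Order.TTheory GRing.Theory Num.Theory.
Local Open Scope ring_scope.

(** * Uniform averages over finite types *)

Section Averages.
Context {R : realFieldType}.
Implicit Types S T : finType.

Lemma eq_avg T (f g : T -> R) : f =1 g -> avg f = avg g.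
Proof. by move=> fg; rewrite /avg (eq_bigr _ (fun i _ => fg i)). Qed.

Lemma avg_const T (c : R) : (0 < #|T|)%N -> avg (fun _ : T => c) = c.
Proof.
move=> T0; rewrite /avg sumr_const -[c *+ _]mulr_natr mulfK //.
by rewrite pnatr_eq0 -lt0n.
Qed.

Lemma avgD T (f g : T -> R) : avg (fun x => f x + g x) = avg f + avg g.
Proof. by rewrite /avg big_split mulrDl. Qed.

Lemma avgZ T (c : R) (f : T -> R) : avg (fun x => c * f x) = c * avg f.
Proof. by rewrite /avg -mulr_sumr mulrA. Qed.

Lemma avgB T (f g : T -> R) : avg (fun x => f x - g x) = avg f - avg g.
Proof. by rewrite /avg sumrB mulrBl. Qed.

Lemma le_avg T (f g : T -> R) : (forall x, f x <= g x) -> avg f <= avg g.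
Proof.
by move=> fg; rewrite /avg ler_wpM2r ?invr_ge0 ?ler0n // ler_sum.
Qed.

Lemma le_norm_avg T (f : T -> R) : `|avg f| <= avg (fun x => `|f x|).
Proof.
rewrite /avg normrM normfV normr_nat.
by rewrite ler_wpM2r ?invr_ge0 ?ler0n // ler_norm_sum.
Qed.

Lemma avg_exchange S T (f : S -> T -> R) :
  avg (fun x => avg (f x)) = avg (fun y => avg (f^~ y)).
Proof.
by rewrite /avg -!mulr_suml exchange_big /= -!mulrA [_^-1 * _]mulrC.
Qed.

Lemma avg_bij S T (h : S -> T) (f : T -> R) :
  bijective h -> avg f = avg (fun x => f (h x)).
Proof.
move=> hb; rewrite /avg (bij_eq_card hb); congr (_ / _).
by apply: reindex; apply: onW_bij.
Qed.

Lemma avg_pair S T (f : S * T -> R) :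
  avg f = avg (fun x => avg (fun y => f (x, y))).
Proof.
rewrite /avg -mulr_suml pair_bigA /= card_prod natrM invfM [_^-1 * _]mulrC mulrA.
by congr (_ / _ / _); apply: eq_bigr => -[].
Qed.

Lemma avg_pred T (P : pred T) : avg (fun x => (P x)%:R) = #|P|%:R / #|T|%:R :> R.
Proof. 
by rewrite /avg -natr_sum -sum1_card [in RHS]big_mkcond.
 Qed.

End Averages.

(** * Densities of the fibres of a homomorphism of finite abelian groups *)

Section Fibers.
Context {R : realFieldType} (G H : finZmodType) (phi : G -> H).
Hypothesis phiD : {morph phi : x y / x + y}.

Lemma avg_shift (f : G -> R) (a : G) : avg (fun x => f (x + a)) = avg f.
Proof.
symmetry; apply: avg_bij; exists (fun x => x - a) => x; [exact: addrK|exact: subrK].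
Qed.

Lemma avg_fiber z0 :
  avg (fun z => (phi z == phi z0)%:R) = avg (fun z => (phi z == 0)%:R) :> R.
Proof.
rewrite -(avg_shift _ z0); apply: eq_avg => z.
by rewrite phiD -subr_eq0 addrK.
Qed.

Lemma sum_avg_fiber : \sum_w avg (fun z => (phi z == w)%:R) = 1 :> R.
Proof.
rewrite /avg -mulr_suml exchange_big /=.
rewrite (eq_bigr (fun=> 1)) => [|z _].
  rewrite sumr_const divff // pnatr_eq0 -lt0n; apply/card_gt0P; by exists 0.
rewrite (bigD1 (phi z)) //= eqxx big1 ?addr0 // => w.
by rewrite eq_sym => /negPf ->.
Qed.

(** Every nonempty fibre is a translate of the kernel and so has its density. At most [#|H|] fibres
    partition [G], so the kernel has at least the average share. *)
Lemma avg_ker_ge : #|H|%:R^-1 <= avg (fun z => (phi z == 0)%:R) :> R.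
Proof.
have H0 : 0 < #|H|%:R :> R by rewrite ltr0n; apply/card_gt0P; exists 0.
rewrite -[leLHS]mul1r ler_pdivrMr // mulr_natr -sumr_const -[leLHS]sum_avg_fiber.
apply: ler_sum => w _; case: (pickP (fun z => phi z == w)) => [z0 /eqP <-|no].
  by rewrite avg_fiber.
rewrite (eq_avg (g := fun=> 0)) => [|z]; last by rewrite no.
rewrite /avg big1 // mul0r divr_ge0 ?ler0n //.
by rewrite sumr_ge0 // => z _; rewrite ler0n.
Qed.

Lemma avg_fiber_surj w :
  (forall v, exists z, phi z = v) -> avg (fun z => (phi z == w)%:R) = #|H|%:R^-1 :> R.
Proof.
move=> surj; have H0 : #|H|%:R != 0 :> R.
  by rewrite pnatr_eq0 -lt0n; apply/card_gt0P; exists 0.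
have e v : avg (fun z => (phi z == v)%:R) = avg (fun z => (phi z == 0)%:R) :> R.
  by have [z0 <-] := surj v; exact: avg_fiber.
apply: (mulIf H0); rewrite mulVf // mulr_natr -sumr_const -[RHS]sum_avg_fiber.
by apply: eq_bigr => v _; rewrite !e.
Qed.

End Fibers.

(** * Autocorrelations and the U^2 norm *)

Lemma avg_correlation {R : realFieldType} (G : finZmodType) (P : pred G) (h : G) :
  let alpha : R := avg (fun x => (P x)%:R) in
  avg (fun x => ((P x)%:R - alpha) * ((P (x + h))%:R - alpha))
    = avg (fun x => (P x && P (x + h))%:R) - alpha ^+ 2.
Proof.
move=> alpha.
have shP : avg (fun x => (P (x + h))%:R) = alpha.
  exact: (avg_shift (fun x => (P x)%:R)).
have G0 : (0 < #|G|)%N by apply/card_gt0P; exists 0.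
transitivity (avg (fun x => (P x && P (x + h))%:R
   - (alpha * ((P x)%:R + (P (x + h))%:R) - alpha ^+ 2))).
  by apply: eq_avg => x; case: (P x); case: (P _) => /=; ring.
rewrite avgB avgB avgZ avgD avg_const // shP -/alpha; ring.
Qed.

(** For a fixed [h], replacing [x + h2] by a free variable splits the fourfold product into two
    independent copies of [f x * f (x + h)]. *)
Lemma U2_pow4E {R : realFieldType} (p n : nat) (f : 'rV['F_p]_n -> R) :
  U2_pow4 f = avg (fun h => (avg (fun x => f x * f (x + h))) ^+ 2).
Proof.
rewrite /U2_pow4 avg_exchange; apply: eq_avg => h.
rewrite expr2 -avgZ; apply: eq_avg => x.
rewrite [RHS]mulrC -avgZ -[RHS](avg_shift _ x); apply: eq_avg => h2.
by rewrite [x + h + h2]addrAC [h2 + x]addrC !mulrA.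
Qed.

(** * Density and autocorrelation of the quadric y . z = 0 *)

Section Quadric.
Context {R : realFieldType} (F : finFieldType).
Local Notation q := (#|F|%:R : R).

Let F_gt0 : 0 < q.
Proof. by rewrite ltr0n; apply/card_gt0P; exists 0. Qed.

Lemma card_rV_inv k : #|{: 'rV[F]_k}|%:R^-1 = q ^- k.
Proof. by rewrite card_mx mul1n natrX. Qed.

(** Independent rows make [z *m M^T] surjective onto F^l, so all its fibres have the same
    density. *)
Lemma avg_row_free l k (M : 'M[F]_(l, k)) w :
  row_free M -> avg (fun z : 'rV[F]_k => (z *m M^T == w)%:R) = q ^- l.
Proof.
move=> Mfree; rewrite -card_rV_inv; apply: avg_fiber_surj => [x y|v].
  exact: mulmxDl.
exists (v *m (pinvmx M)^T); rewrite -mulmxA -trmx_mul mulmxVp //.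
by rewrite trmx1 mulmx1.
Qed.

Definition dotp k (y z : 'rV[F]_k) : F := (z *m y^T) 0 0.

Lemma dotp_scalar k (y z : 'rV[F]_k) : z *m y^T = (dotp y z)%:M.
Proof. exact: mx11_scalar. Qed.

Lemma mul_tr_eq0 k (y z : 'rV[F]_k) : (z *m y^T == 0) = (dotp y z == 0).
Proof.
apply/eqP/eqP => e; first by rewrite /dotp e mxE.
by rewrite dotp_scalar e raddf0.
Qed.

Lemma dotpDl k (y y' z : 'rV[F]_k) : dotp (y + y') z = dotp y z + dotp y' z.
Proof. by rewrite /dotp linearD mulmxDr mxE. Qed.

Lemma dotpDr k (y z z' : 'rV[F]_k) : dotp y (z + z') = dotp y z + dotp y z'.
Proof. by rewrite /dotp mulmxDl mxE. Qed.

Definition quadric k : {set 'rV[F]_(k + k)} :=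
  [set x | dotp (lsubmx x) (rsubmx x) == 0].

Lemma in_quadric k (y z : 'rV[F]_k) : (row_mx y z \in quadric k) = (dotp y z == 0).
Proof. by rewrite inE row_mxKl row_mxKr. Qed.

Lemma row_mx_bij (l k k' : nat) :
  bijective (fun x : 'M[F]_(l, k) * 'M[F]_(l, k') => row_mx x.1 x.2).
Proof.
exists (fun x => (lsubmx x, rsubmx x)) => [[y z]|x] /=.
  by rewrite row_mxKl row_mxKr.
by rewrite hsubmxK.
Qed.

Lemma avg_row_mx k k' (f : 'rV[F]_(k + k') -> R) :
  avg f = avg (fun y => avg (fun z => f (row_mx y z))).
Proof. by rewrite (avg_bij f (row_mx_bij 1 k k')) avg_pair. Qed.

Lemma avg_eq0 k : avg (fun y : 'rV[F]_k => (y == 0)%:R) = q ^- k.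
Proof. by rewrite avg_pred card1 card_rV_inv mul1r. Qed.

(** The fibre over [y] is a hyperplane of density [q^-1] when [y] is nonzero, and the whole space
    when [y] is zero. *)
Lemma avg_quadric k :
  avg (fun x => (x \in quadric k)%:R) = q^-1 + (1 - q^-1) * q ^- k.
Proof.
rewrite avg_row_mx; transitivity (avg (fun y : 'rV[F]_k => q^-1 + (1 - q^-1) * (y == 0)%:R)).
  apply: eq_avg => y; under eq_avg do rewrite in_quadric.
  have [->|y0] := eqVneq y 0.
    rewrite (eq_avg (g := fun=> 1)) => [|z]; last by rewrite /dotp trmx0 mulmx0 mxE eqxx.
    by rewrite avg_const /=; [ring|apply/card_gt0P; exists 0].
  rewrite mulr0 addr0 -[q^-1]/(q ^- 1) -(@avg_row_free _ _ y 0) => [|].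
    by apply: eq_avg => z; rewrite mul_tr_eq0.
  by rewrite /row_free rank_rV y0.
rewrite avgD avgZ avg_eq0 avg_const //; apply/card_gt0P; by exists 0.
Qed.

(** In a relation s y + t a = 0, a nonzero s would put [y] on the line of [a]; hence s = 0, and then
    t = 0 because [a] is nonzero. *)
Lemma row_free_col_mx k (y a : 'rV[F]_k) :
  a != 0 -> ~~ (y <= a)%MS -> row_free (col_mx y a).
Proof.
move=> a0 ya; apply: inj_row_free => v.
rewrite -[v]hsubmxK mul_row_col [lsubmx v]mx11_scalar [rsubmx v]mx11_scalar.
move: (lsubmx v 0 0) (rsubmx v 0 0) => s t; rewrite !mul_scalar_mx => e.
have s0 : s = 0.
  apply/eqP; apply: contraR ya => s0; apply/sub_rVP; exists (- (s^-1 * t)).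
  move/eqP: e; rewrite addr_eq0 => /eqP e.
  by rewrite scaleNr -scalerA -scalerN -e scalerA mulVf ?scale1r.
move: e; rewrite s0 scale0r add0r => /eqP; rewrite scaler_eq0 (negPf a0) orbF.
by move=> /eqP ->; rewrite raddf0 row_mx0.
Qed.

Lemma avg_sub_line k (a : 'rV[F]_k) : avg (fun y : 'rV[F]_k => (y <= a)%MS%:R) <= q * q ^- k.
Proof.
rewrite avg_pred card_rV_inv; apply: ler_wpM2r; first by rewrite invr_ge0 exprn_ge0 ?ltW.
rewrite ler_nat.
apply: leq_trans (leq_imset_card (fun c : F => c *: a) predT).
apply/subset_leq_card/subsetP => y; rewrite unfold_in => /sub_rVP[c ->].
by apply/imsetP; exists c.
Qed.

(** Write h = (a, b). For [y] off the line of [a] the density in z is exactly [q ^- 2], so the error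
    comes only from the at most [q] vectors [y] on that line, each contributing at most 1. *)
Lemma quadric_correlation k (h : 'rV[F]_(k + k)) : lsubmx h != 0 ->
  `|avg (fun x => ((x \in quadric k) && (x + h \in quadric k))%:R) - q ^- 2|
    <= q * q ^- k.
Proof.
rewrite -[h]hsubmxK row_mxKl; move: (lsubmx h) (rsubmx h) => a b a0.
rewrite avg_row_mx -[q ^- 2](@avg_const _ 'rV[F]_k); last by apply/card_gt0P; exists 0.
rewrite -avgB; apply: le_trans (le_norm_avg _) _.
apply: le_trans (avg_sub_line a); apply: le_avg => y.
have q2 : 0 <= q ^- 2 <= 1.
  have q1 : 1 <= q by rewrite ler1n; apply/card_gt0P; exists 0.
  have c1 : 0 < q^-1 <= 1 by rewrite invr_gt0 F_gt0 invf_le1.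
  by rewrite -exprVn exprn_ge0 ?exprn_ile1 //; lra.
have [ya|ya] := boolP (y <= a)%MS.
  have rV0 : (0 < #|{: 'rV[F]_k}|)%N by apply/card_gt0P; exists 0.
  set e := avg _; have : 0 <= e <= 1.
    rewrite -{1}(avg_const 0 rV0) -(avg_const 1 rV0) /e.
    by apply/andP; split; apply: le_avg => z; case: (_ && _).
  by rewrite ler_norml /= mulr1n; lra.
rewrite -[2%N]/(1 + 1)%N.
(* Given y . z = 0, the equation (y + a) . (z + b) = 0 reads a . z = -(y . b + a . b), which gives
   the second coordinate of the target. *)
rewrite -(@avg_row_free _ _ (col_mx y a) (row_mx 0 (- (dotp y b + dotp a b))%:M)).
  rewrite [leLHS](_ : _ = 0) //; apply/eqP; rewrite normr_eq0 subr_eq0.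
  apply/eqP/eq_avg => z; congr (_%:R); congr nat_of_bool.
  rewrite add_row_mx !in_quadric tr_col_mx mul_mx_row !dotp_scalar.
  rewrite dotpDl !dotpDr; apply/andP/eqP => [[/eqP -> /eqP e]|/eq_row_mx[/eqP e1 e2]].
    congr row_mx; first by rewrite raddf0.
    by congr (_%:M); apply/eqP; rewrite -addr_eq0 -e; apply/eqP; ring.
  rewrite -dotp_scalar mul_tr_eq0 in e1; move/eqP: e1 => e1.
  move/(congr1 (fun M : 'M_1 => M 0 0)): e2; rewrite !mxE eqxx !mulr1n => ->.
  by rewrite e1 eqxx; split=> //; apply/eqP; ring.
exact: row_free_col_mx.
Qed.

End Quadric.

(** * Elementary estimates for powers *)

Lemma exprn_le_linear {R : realFieldType} (a b : R) m :
  0 <= b <= a -> a <= 1 -> a ^+ m <= b ^+ m + m%:R * (a - b).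
Proof.
move=> /andP[b0 ba] a1; elim: m => [|m IH]; first by rewrite !expr0 mul0r addr0.
have bm : b ^+ m <= 1 by rewrite exprn_ile1 //; lra.
rewrite !exprS -natr1.
(* The quantities in [H1], [H2] and [H3] add up to the right side minus the left side of the
   goal. *)
have H1 : 0 <= a * (b ^+ m + m%:R * (a - b) - a ^+ m) by apply: mulr_ge0; lra.
have H2 : 0 <= (a - b) * (1 - b ^+ m) by apply: mulr_ge0; lra.
have H3 : 0 <= m%:R * (a - b) * (1 - a) by rewrite !mulr_ge0 ?ler0n //; lra.
lra.
Qed.

Lemma exists_expV_le {R : archiRealFieldType} (p : nat) (e : R) :
  (1 < p)%N -> 0 < e -> exists k, p%:R ^- k <= e.
Proof.
move=> p1 e0; exists (Num.bound e^-1).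
have p0 : 0 < p%:R :> R by rewrite ltr0n ltnW.
rewrite -[leRHS]invrK lef_pV2 ?posrE ?exprn_gt0 ?invr_gt0 //.
apply: le_trans (ltW (archi_boundP _)) _; first by rewrite invr_ge0 ltW.
by rewrite -natrX ler_nat ltnW // ltn_expl.
Qed.

(** * Uniformity and pattern counts of the quadric over F_p *)

Section Patterns.
Context {R : realFieldType} (p : nat).
Local Notation q := (#|'F_p|%:R : R).

Lemma density_avg n (A : {set 'rV['F_p]_n}) :
  prime p -> density R A = avg (fun x => (x \in A)%:R).
Proof.
by move=> pr; rewrite avg_pred card_mx mul1n card_Fp //; congr (_%:R / _); apply: eq_card.
Qed.

Lemma U2_pow4_quadric k (alpha : R) :
  alpha = avg (fun x => (x \in quadric 'F_p k)%:R) ->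
  U2_pow4 (fun x => (x \in quadric 'F_p k)%:R - alpha)
    <= ((q + 2) ^+ 2 + 1) * q ^- k.
Proof.
move=> alphaE; rewrite U2_pow4E.
have q1 : 1 <= q by rewrite ler1n; apply/card_gt0P; exists 0.
have q0 : 0 < q by lra.
have c1 : 0 < q^-1 <= 1 by rewrite invr_gt0 q0 invf_le1.
have u1 : 0 < q ^- k <= 1 by rewrite -exprVn exprn_gt0 ?exprn_ile1 //; lra.
have alphaE' : alpha = q^-1 + (1 - q^-1) * q ^- k by rewrite alphaE avg_quadric.
have q2 : q ^- 2 = q^-1 * q^-1 by rewrite -exprVn expr2.
have alpha1 : q^-1 <= alpha <= 1 /\ alpha <= q^-1 + q ^- k.
  rewrite alphaE'; move: c1 u1; set c := q^-1; set u := q ^- k; clear; nra.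
(* The indicator pays for shifts with zero first half, where the correlation is only known to lie in
   [-1, 1]; these shifts have density [q ^- k]. *)
apply: (@le_trans _ _ (avg (fun h : 'rV['F_p]_(k + k) =>
    (q + 2) ^+ 2 * q ^- k + (lsubmx h == 0)%:R))).
  apply: le_avg => h.
  have rV0 : (0 < #|{: 'rV['F_p]_(k + k)}|)%N by apply/card_gt0P; exists 0.
  have [h0|h0] := eqVneq (lsubmx h) 0.
    set e := avg _; have e1 : -1 <= e <= 1.
      rewrite -ler_norml; apply: le_trans (le_norm_avg _) _.
      rewrite -[leRHS](avg_const _ rV0); apply: le_avg => x.
      by rewrite ler_norml; do 2 case: (_ \in _) => /=; nra.
    have : 0 <= (q + 2) ^+ 2 * q ^- k by rewrite mulr_ge0 ?sqr_ge0 //; lra.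
    have : 0 <= (1 - e) * (1 + e) by apply: mulr_ge0; lra.
    rewrite expr2 /=; lra.
  rewrite alphaE (avg_correlation (fun x => x \in quadric 'F_p k)) -alphaE addr0.
  have := quadric_correlation (R := R) h0; rewrite q2 ler_norml.
  set e := avg _; rewrite -[alpha ^+ 2]/(alpha * alpha) => eP.
  (* The [q] comes from [quadric_correlation]; the 2 comes from alpha^2 - q^-2 = (alpha -
     q^-1)(alpha + q^-1), whose factors are at most [q ^- k] and 2. *)
  have : - ((q + 2) * q ^- k) <= e - alpha * alpha <= (q + 2) * q ^- k.
    move: c1 u1 alpha1 eP; set c := q^-1; set u := q ^- k; set Q := q; clear; nra.
  rewrite -ler_norml => {}eP.
  rewrite -real_normK ?num_real //.
  apply: (@le_trans _ _ (((q + 2) * q ^- k) ^+ 2)); first by rewrite ler_sqr // ?nnegrE //; nra.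
  rewrite exprMn ler_wpM2l ?sqr_ge0 // expr2 ler_piMr; lra.
rewrite avgD avg_const ?mulrDl ?lerD2l ?mul1r; last by apply/card_gt0P; exists 0.
rewrite avg_row_mx -avg_eq0; apply: le_avg => y.
rewrite -[leRHS](@avg_const _ 'rV['F_p]_k); last by apply/card_gt0P; exists 0.
by apply: le_avg => z; rewrite row_mxKl.
Qed.

(** A [d]-tuple of points (y_r, z_r) is stored as two matrices with rows y_r and z_r, so that a
    linear form acts on both as left multiplication by its coefficient row. *)
Lemma linform_row_mx d k (g : 'I_d -> 'F_p) (y z : 'M['F_p]_(d, k)) :
  linform g [ffun r => row_mx (row r y) (row r z)]
    = row_mx ((\row_r g r) *m y) ((\row_r g r) *m z).
Proof.
rewrite /linform -[LHS]hsubmxK; congr row_mx; rewrite mulmx_sum_row linear_sum;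
  by apply: eq_bigr => r _; rewrite ffunE linearZ /= ?row_mxKl ?row_mxKr mxE.
Qed.

Lemma rows_bij d k : bijective (fun x : 'M['F_p]_(d, k) * 'M['F_p]_(d, k) =>
  [ffun r => row_mx (row r x.1) (row r x.2)] : {ffun 'I_d -> 'rV['F_p]_(k + k)}).
Proof.
exists (fun x : {ffun 'I_d -> 'rV['F_p]_(k + k)} =>
  (\matrix_r lsubmx (x r), \matrix_r rsubmx (x r))) => [[y z]|x] /=.
  by congr pair; apply/row_matrixP => r; rewrite rowK ffunE ?row_mxKl ?row_mxKr.
by apply/ffunP => r; rewrite ffunE !rowK hsubmxK.
Qed.

(** After expansion, z_r . y_s is multiplied by the (r, s) entry of the vanishing combination of the
    matrices Gamma^(i). *)
Lemma sum_dotp_dep m d k (gamma : 'I_m -> 'I_d -> 'F_p) (c : 'I_m -> 'F_p)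
    (y z : 'M['F_p]_(d, k)) :
  (forall r s, \sum_i c i * (gamma i r * gamma i s) = 0) ->
  \sum_i c i * dotp ((\row_r gamma i r) *m y) ((\row_r gamma i r) *m z) = 0.
Proof.
move=> dep.
transitivity (\sum_i \sum_s \sum_r c i * (gamma i r * gamma i s) * (z *m y^T) r s).
  apply: eq_bigr => i _; rewrite /dotp trmx_mul mulmxA -[_ *m z *m _]mulmxA mxE mulr_sumr.
  apply: eq_bigr => s _; rewrite !mxE mulr_suml mulr_sumr.
  by apply: eq_bigr => r _; rewrite !mxE; ring.
rewrite exchange_big big1 // => s _; rewrite exchange_big big1 // => r _.
by rewrite -mulr_suml dep mul0r.
Qed.

(** There are [m.+1] forms. For each fixed [y], the conditions other than that of [i0] say that [z]
    lies in the kernel of a homomorphism into F_p^m. The condition of [i0] then follows from the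
    dependence, since [c i0] is invertible. *)
Lemma pattern_prob_quadric m d k (gamma : 'I_m.+1 -> 'I_d -> 'F_p) :
  quad_forms_lin_dep gamma -> q ^- m <= pattern_prob R gamma (quadric 'F_p k).
Proof.
case=> c [[i0 c0] dep]; rewrite /pattern_prob (avg_bij _ (rows_bij d k)) avg_pair.
rewrite -[leLHS](@avg_const _ 'M['F_p]_(d, k)); last by apply/card_gt0P; exists 0.
apply: le_avg => y.
pose G i := \row_r gamma i r.
pose phi (z : 'M_(d, k)) := \row_j dotp (G (lift i0 j) *m y) (G (lift i0 j) *m z).
have phiD : {morph phi : z z' / z + z'}.
  by move=> z z'; apply/rowP => j; rewrite !mxE mulmxDr dotpDr.
rewrite -card_rV_inv; apply: le_trans (avg_ker_ge phiD) _; apply: le_avg => z.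
case: eqP => [e|_]; last by rewrite ler0n.
suff -> : [forall i, linform (gamma i) [ffun r => row_mx (row r (y, z).1) (row r (y, z).2)]
   \in quadric 'F_p k] by [].
have e' j : dotp (G (lift i0 j) *m y) (G (lift i0 j) *m z) = 0.
  by move/rowP/(_ j): e; rewrite !mxE.
apply/forallP => i; rewrite linform_row_mx in_quadric -/(G i).
have [j|] := unliftP i0 i => ->; first by rewrite e'.
have := sum_dotp_dep y z dep; rewrite (bigD1 i0) //= big1 => [|i' ne].
  by rewrite addr0 => /eqP; rewrite mulf_eq0 (negPf c0).
have [j ->|ei] := unliftP i0 i'; first by rewrite -/(G _) e' mulr0.
by rewrite ei eqxx in ne.
Qed.

End Patterns.

(** * Choice of parameters and conclusion *)

Theorem theorem3p1 (R : realType) (p m d : nat) (gamma : 'I_m -> 'I_d -> 'F_p) :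
  prime p -> odd p -> quad_forms_lin_dep gamma ->
  exists eps : R, 0 < eps /\
    forall delta : R, 0 < delta ->
      exists (n : nat) (A : {set 'rV['F_p]_n}),
        let alpha : R := density R A in
        U2norm (fun x : 'rV['F_p]_n => ((x \in A) : bool)%:R - alpha) <= delta /\
        pattern_prob R gamma A >= alpha ^+ m + eps.
Proof.
(* A dependence has a nonzero coefficient, so there is at least one form; from here on the number of
   forms is [m.+1]. *)
move=> pr _ dep; case: m gamma dep => [|m] gamma dep; first by case: dep => c [[[]]].
have p1 : 1 < p%:R :> R by rewrite ltr1n prime_gt1.
have p0 : 0 < p%:R :> R by lra.
have c1 : 0 < (p%:R^-1 : R) < 1 by rewrite invr_gt0 p0 invf_lt1.
have cm : 0 < p%:R ^- m :> R by rewrite invr_gt0 exprn_gt0.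
(* Half of the gap between the pattern bound p^-m and p^-(m+1); the other half absorbs the excess of
   alpha^(m+1) over p^-(m+1). *)
pose eps : R := (p%:R ^- m - p%:R ^- m.+1) / 2.
have eps0 : 0 < eps.
  rewrite divr_gt0 // subr_gt0 -!exprVn exprS exprVn; nra.
exists eps; split=> // delta delta0.
pose K : R := (p%:R + 2) ^+ 2 + 1.
have K0 : 0 < K by rewrite ltr_wpDl ?sqr_ge0.
(* The first bound on p^-k controls the excess of the density over 1/p, the second the U^2 norm
   through [U2_pow4_quadric]. *)
have e0 : 0 < Num.min (eps / m.+1%:R) (delta ^+ 4 / K).
  by rewrite lt_min; apply/andP; split; apply: divr_gt0; rewrite ?exprn_gt0 ?ltr0n.
have [k] := exists_expV_le (prime_gt1 pr) e0; rewrite le_min => /andP[ke kd].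
exists (k + k)%N, (quadric 'F_p k); set alpha := density _ _; cbv zeta.
have alphaE : alpha = avg (fun x => (x \in quadric 'F_p k)%:R) by exact: density_avg.
have u1 : 0 < (p%:R ^- k : R) <= 1 by rewrite -exprVn exprn_gt0 ?exprn_ile1 //; lra.
split.
  have := U2_pow4_quadric alphaE; rewrite card_Fp // => U2.
  rewrite /U2norm.
  (* The fourth power of [delta] is written as an iterated square so that each of the two nested
     roots in [U2norm] cancels one square. *)
  have X : U2_pow4 (fun x : 'rV['F_p]_(k + k) => (x \in quadric 'F_p k)%:R - alpha)
      <= (delta ^+ 2) ^+ 2.
    by apply: le_trans U2 _; rewrite -exprM mulrC -ler_pdivlMr.
  apply: le_trans (ler_wsqrtr (ler_wsqrtr X)) _.
  by rewrite sqrtr_sqr ger0_norm ?sqr_ge0 // sqrtr_sqr ger0_norm // ltW.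
have := pattern_prob_quadric (R := R) k dep; rewrite card_Fp //; apply: le_trans.
have alphaE' : alpha = p%:R^-1 + (1 - p%:R^-1) * p%:R ^- k.
  by rewrite alphaE avg_quadric card_Fp.
have alpha1 : p%:R^-1 <= alpha <= 1 /\ alpha <= p%:R^-1 + p%:R ^- k.
  rewrite alphaE'; move: c1 u1; set c := p%:R^-1; set u := p%:R ^- k; clear; nra.
have L : alpha ^+ m.+1 <= p%:R^-1 ^+ m.+1 + m.+1%:R * (alpha - p%:R^-1).
  by apply: exprn_le_linear; lra.
have M : m.+1%:R * (alpha - p%:R^-1) <= eps.
  rewrite mulrC -ler_pdivlMr ?ltr0n //; apply: le_trans ke.
  by rewrite lerBlDl; case: alpha1.
rewrite exprVn in L; move: M L; rewrite /eps; lra.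
Qed.
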